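(* Let $n\geq 1$. The square matrix $A=(\chi_{\lambda}^{\mu})_{\lambda,\mu}$, with rows and columns indexed by the partitions of $n$, is invertible.
   Context: For a partition $\mu=(\mu_1,\ldots,\mu_l)$ of $n$, $S_\mu$ denotes the subgroup $S_{\mu_1}\times\cdots\times S_{\mu_l}<S_n$. For a partition $\lambda$ of $n$, $V_\lambda$ denotes the irreducible complex representation of $S_n$ associated to $\lambda$. The number $\chi_\lambda^\mu$ is the dimension of the subspace $V_\lambda^{\mu}$ of $V_\lambda$ consisting of the vectors invariant under the action of $S_\mu$. *)

(* Defs.v *)
From HB Require Import structures.
From mathcomp Require Import all_boot all_order all_algebra all_fingroup.
From mathcomp Require Import mxrepresentation.
From mathcomp Require Export reals complex.

Set Implicit Arguments.
Unset Strict Implicit.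
Unset Printing Implicit Defensive.

Import GroupScope GRing.Theory.

Definition is_partition (n : nat) (s : seq nat) : bool :=
  [&& sorted geq s, 0 \notin s & sumn s == n].

Record intpart (n : nat) :=
  IntPart { parts :> seq nat; _ : is_partition n parts }.

HB.instance Definition _ n := [isSub for @parts n].
HB.instance Definition _ n := [Countable of intpart n by <:].

Section Finiteness.

Variable n : nat.

Lemma mem_partition_leq (s : seq nat) m : m \in s -> m <= sumn s.
Proof.
elim: s => //= a s IHs; rewrite inE => /orP[/eqP-> | /IHs le_m].
  exact: leq_addr.
exact: leq_trans le_m (leq_addl _ _).
Qed.

Lemma size_partition_leq (s : seq nat) : 0 \notin s -> size s <= sumn s.
Proof.
elim: s => //= a s IHs; rewrite inE negb_or eq_sym -lt0n => /andP[a_gt0 /IHs].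
by move=> le_s; rewrite -add1n leq_add.
Qed.

Definition ffun_of_intpart (p : intpart n) : {ffun 'I_n -> 'I_n.+1} :=
  [ffun i => inord (nth 0 p (val i))].

Definition intpart_of_ffun (f : {ffun 'I_n -> 'I_n.+1}) : option (intpart n) :=
  insub [seq x <- [seq val (f i) | i <- enum 'I_n] | x != 0].

Lemma ffun_of_intpartK : pcancel ffun_of_intpart intpart_of_ffun.
Proof.
case=> s s_part; rewrite /intpart_of_ffun.
have /and3P[_ s_pos /eqP sum_s] := s_part.
have -> : [seq val (ffun_of_intpart (IntPart s_part) i) | i <- enum 'I_n]
          = [seq nth 0 s i | i <- iota 0 n].
  rewrite -val_enum_ord -map_comp; apply: eq_map => i /=.
  rewrite ffunE inordK // ltnS /=.
  have [lt_is | ge_is] := ltnP i (size s); last by rewrite nth_default.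
  by rewrite -[X in _ <= X]sum_s mem_partition_leq ?mem_nth.
have le_sn : size s <= n by rewrite -sum_s size_partition_leq.
have -> : iota 0 n = iota 0 (size s) ++ iota (size s) (n - size s).
  by rewrite -iotaD subnKC.
rewrite map_cat filter_cat map_nth_iota0 // take_size.
rewrite (all_filterP _); last first.
  by apply/allP=> x s_x; apply: contraNneq s_pos => <-.
rewrite (_ : filter _ _ = [::]) ?cats0; first by rewrite insubT.
apply/eqP; rewrite -[_ == _]negbK -has_filter -all_predC.
apply/allP=> _ /mapP[i + ->]; rewrite mem_iota => /andP[le_si _] /=.
by rewrite nth_default.
Qed.

HB.instance Definition _ : isFinite (intpart n) :=
  PCanIsFinite ffun_of_intpartK.

End Finiteness.

(* The Young diagram of la is filled with 0, ..., n - 1 row by row: the entry  *)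
(* k lies in row [reshape_index la k] and column [reshape_offset la k].        *)

Definition fiber_stab (n : nat) (f : nat -> nat) : {set 'S_n} :=
  [set s : 'S_n | [forall i, f (s i) == f i]].

Lemma fiber_stab_group_set n f : group_set (@fiber_stab n f).
Proof.
apply/group_setP; split=> [|s t].
  by rewrite inE; apply/forallP=> i; rewrite perm1.
rewrite !inE => /forallP fs /forallP ft; apply/forallP=> i.
by rewrite permM (eqP (ft _)).
Qed.

Canonical fiber_stab_group n f := Group (@fiber_stab_group_set n f).

Definition young_subgroup n (mu : intpart n) : {group 'S_n} :=
  [group of fiber_stab n (reshape_index mu)].

Definition column_subgroup n (la : intpart n) : {group 'S_n} :=
  [group of fiber_stab n (reshape_offset la)].

Local Open Scope ring_scope.

(* The Young symmetrizer, as an endomorphism of the regular representation.    *)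
(* Permutations compose from left to right, [(s * t) i = t (s i)], so the      *)
(* usual product (row sum) o (column sum) of permutations composed as          *)
(* functions has its factors in the opposite order here.                       *)
Definition young_symmetrizer (F : fieldType) n (la : intpart n) :
    'M[F]_#|[set: 'S_n]| :=
  let aG := regular_repr F [set: 'S_n]%G in
  (\sum_(q in column_subgroup la) (-1) ^+ odd_perm q *: aG q)
    *m (\sum_(p in young_subgroup la) aG p).

(* The representation V_la: the submodule of the regular representation        *)
(* generated by the Young symmetrizer. Row vectors are acted upon on the       *)
(* right, which for left-to-right composition is the usual left action.        *)
Definition specht_repr (F : fieldType) n (la : intpart n) :=
  submod_repr (cyclic_mx_module (regular_repr F [set: 'S_n]%G)
                 (gring_row (young_symmetrizer F la))).

Definition chi (F : fieldType) n (la mu : intpart n) : nat :=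
  \rank (rfix_mx (specht_repr F la) (young_subgroup mu)).

(* The integers chi_la^mu are taken in the field of rationals, so that         *)
(* invertibility means having a nonzero determinant.                           *)
Definition chi_matrix (F : fieldType) n : 'M[rat]_#|{: intpart n}| :=
  \matrix_(i, j) (chi F (enum_val i) (enum_val j))%:R.

(* Main.v *)
(* The matrix is triangular with nonzero diagonal for the dominance order on
   partitions. If b is the column antisymmetrizer of la and a the row
   symmetrizer of mu, a transposition preserving the columns of la whose
   conjugate by g preserves the rows of mu forces b g a = - b g a, so
   b g a <> 0 implies that la dominates mu; and chi la mu <> 0 implies
   b g a <> 0 for some g. On the diagonal, the Young symmetrizer generating
   V_la is itself invariant under S_la, and it is nonzero since its coefficient
   at the identity is 1. *)
Require Import Defs.
From mathcomp Require Import all_boot all_order all_algebra.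
From mathcomp Require Import all_fingroup mxrepresentation.

Set Implicit Arguments.
Unset Strict Implicit.
Unset Printing Implicit Defensive.

Import GRing.Theory Num.Theory.

(** * Cells in the first rows of a diagram *)

Lemma reshape_index_lt sh i k :
  i < sumn sh -> (reshape_index sh i < k) = (i < sumn (take k sh)).
Proof.
rewrite /reshape_index; elim: sh => //= m sh IHsh in i k *.
rewrite subn_eq0; have [lt_im _ | le_mi lt_i] := ltnP i m.
  by case: k => //= k; rewrite (leq_trans lt_im) ?leq_addr.
by case: k => //= k; rewrite ltnS subSn // IHsh -?ltn_subLR ?ltn_subLR //.
Qed.

(** Since the filling is row by row, the first [k] rows hold an initial segment of the entries. *)
Lemma card_reshape_index_lt n sh k : sumn sh = n ->
  #|[set i : 'I_n | reshape_index sh i < k]| = sumn (take k sh).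
Proof.
move=> sum_sh; have le_k: sumn (take k sh) <= n.
  by rewrite -sum_sh -{2}(cat_take_drop k sh) sumn_cat leq_addr.
rewrite -sum1_card.
rewrite (eq_bigl (fun i : 'I_n => i < sumn (take k sh))) => [|i].
  by rewrite -(big_ord_widen n (fun=> 1) le_k) sum1_card card_ord.
by rewrite inE reshape_index_lt // sum_sh.
Qed.

(** * Dominance order and prefix weights *)

Definition dominates (s t : seq nat) :=
  forall k, sumn (take k t) <= sumn (take k s).

Section Dominance.

Variable n : nat.
Implicit Types la mu : intpart n.

Lemma sumn_intpart la : sumn la = n.
Proof. by case: la => s /= /and3P[_ _ /eqP]. Qed.

Lemma nth_intpart_anti la i j : i <= j -> nth 0 la j <= nth 0 la i.
Proof.
move=> le_ij; have [lt_j | ge_j] := ltnP j (size la); last first.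
  by rewrite [X in X <= _]nth_default.
have sorted_la: sorted geq la by case: (la) => s /= /and3P[].
have geq_tr: transitive geq.
  by move=> y x z /= le_yx le_zy; apply: leq_trans le_yx.
apply: (sorted_leq_nth geq_tr leqnn 0 sorted_la) => //.
exact: leq_ltn_trans lt_j.
Qed.

Lemma intpart_cellK la (i j : 'I_n) :
  reshape_index la i = reshape_index la j ->
  reshape_offset la i = reshape_offset la j -> i = j.
Proof.
move=> eq_r eq_c; apply: val_inj.
by rewrite /= -(reshape_indexK la i) eq_r eq_c reshape_indexK.
Qed.

(* In each column of [la], the cells that [g] sends to the first [k] rows of  *)
(* [mu] are at most [k] in number, hence no more than the cells of that       *)
(* column lying in the first [k] rows of [la].                                *)
Lemma transversal_dominates la mu (g : 'S_n) :
    (forall i j : 'I_n, reshape_offset la i = reshape_offset la j ->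
       reshape_index mu (g i) = reshape_index mu (g j) -> i = j) ->
  dominates la mu.
Proof.
move=> g_transv k.
rewrite -(card_reshape_index_lt k (sumn_intpart mu)).
rewrite -(card_reshape_index_lt k (sumn_intpart la)).
set X := [set i | _]; set Y := [set i | _].
rewrite -(card_preimset X (@perm_inj _ g)).
(* Both sets are counted column by column; [inord] loses nothing, a column number being at most
   [i]. *)
pose c (i : 'I_n) : 'I_n.+1 := inord (reshape_offset la i).
have cE i j : c i = j -> reshape_offset la i = j.
  move <-; rewrite inordK // ltnS (leq_trans (leq_subr _ _)) //.
  exact: ltnW.
rewrite -!sum1_card !(partition_big c predT) //=.
apply: leq_sum => j _; rewrite !sum1_card.
pose Xj := [pred i | (i \in g @^-1: X) && (c i == j)].
pose Yj := [pred i | (i \in Y) && (c i == j)].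
change (#|Xj| <= #|Yj|).
(* If column [j] stops before row [k], all its cells lie in [Y]. Otherwise [k] separates the two
   counts. *)
have [/existsP[i0 /andP[/eqP/cE c_i0 le_k]] | no_low] :=
  boolP [exists i, (c i == j) && (k <= reshape_index la i)]; last first.
  apply/subset_leq_card/subsetP=> i; rewrite !inE => /andP[_ c_i].
  rewrite c_i andbT ltnNge; apply: contra no_low => le_k.
  by apply/existsP; exists i; rewrite c_i.
apply: (@leq_trans k).
  case: k @X @Y @Xj @Yj le_k => [|k] X Y Xj Yj _.
    by rewrite eq_card0 // => i; rewrite !inE.
  pose f i : 'I_k.+1 := inord (reshape_index mu (g i)).
  rewrite -(card_ord k.+1) -(@card_in_image _ _ f Xj) ?max_card // => x y.
  rewrite !inE => /andP[x_k /eqP/cE c_x] /andP[y_k /eqP/cE c_y] /(congr1 val).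
  by rewrite /= !inordK // => eq_r; apply: g_transv; rewrite ?c_x ?c_y.
(* [h r] is the cell of [la] in row [r] and column [j]: row [r] is at least as long as the row of
   [i0], which reaches column [j]. The default [i0] is thus never taken. *)
pose h (r : 'I_k) : 'I_n := insubd i0 (flatten_index la r j).
have lt_j (r : 'I_k) : j < nth 0 la r.
  apply: leq_trans (nth_intpart_anti la (leq_trans (ltnW (ltn_ord r)) le_k)).
  by rewrite -c_i0; apply: reshape_offsetP; rewrite sumn_intpart.
have hE r : h r = flatten_index la r j :> nat.
  have := flatten_indexP (lt_j r); rewrite sumn_intpart => lt_n.
  by rewrite val_insubd lt_n.
have h_inj: injective h.
  move=> r r' /(congr1 (fun i : 'I_n => reshape_index la i)).
  by rewrite !hE !flatten_indexKl // => /val_inj.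
rewrite -(card_ord k) -(card_codom h_inj).
apply/subset_leq_card/subsetP=> _ /codomP[r ->].
rewrite !inE hE flatten_indexKl //= ltn_ord /=.
by apply/eqP/val_inj; rewrite /c hE flatten_indexKr //= inordK.
Qed.

Definition prefix_weight (s : seq nat) := \sum_(k < n.+1) sumn (take k s).

Lemma sumn_take_nth s k : sumn (take k.+1 s) = sumn (take k s) + nth 0 s k.
Proof.
have [lt_k | ge_k] := ltnP k (size s).
  by rewrite (take_nth 0) // sumn_rcons.
by rewrite !take_oversize ?nth_default ?addn0 // ltnW.
Qed.

(** Equal totals force every prefix sum to agree, and the parts are the differences of consecutive
    prefix sums. *)
Lemma dominates_weight la mu : dominates la mu ->
  prefix_weight mu <= prefix_weight la ?= iff (la == mu).
Proof.
move=> dom; apply/leqifP; case: eqP => [-> //| ne_la_mu].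
have le_w: prefix_weight mu <= prefix_weight la by apply: leq_sum.
rewrite ltn_neqAle le_w andbT; apply: contra_not_neq ne_la_mu => eq_w.
have eq_take (k : 'I_n.+1) : sumn (take k mu) = sumn (take k la).
  have [_ ] := leqif_sum (fun (i : 'I_n.+1) (_ : true) => leqif_eq (dom i)).
  rewrite -/(prefix_weight _) -/(prefix_weight _) eq_w eqxx.
  by move/esym/forallP/(_ k)/eqP.
apply: (pcan_inj (@ffun_of_intpartK n)); apply/ffunP=> i; rewrite !ffunE.
congr inord; apply/eqP; rewrite -(eqn_add2l (sumn (take i la))).
rewrite -sumn_take_nth -[in X in _ == X](eq_take (widen_ord (leqnSn n) i)).
by rewrite -sumn_take_nth (eq_take (lift ord0 i)).
Qed.

End Dominance.

Local Open Scope ring_scope.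

(** * Row and column symmetrizers *)

Section Symmetrizers.

Variables (F : fieldType) (n : nat).
Hypothesis char0 : [pchar F] =i pred0.
Implicit Types la mu : intpart n.

Let G := [set: 'S_n]%G.
Let aG := regular_repr F G.

Definition row_symmetrizer mu := \sum_(p in young_subgroup mu) aG p.
Definition column_antisymmetrizer la :=
  \sum_(q in column_subgroup la) (-1) ^+ odd_perm q *: aG q.

Lemma regular_reprM (s t : 'S_n) : aG (s * t)%g = aG s *m aG t.
Proof. by rewrite repr_mxM ?inE. Qed.

Lemma row_symmetrizer_mull mu p :
  p \in young_subgroup mu -> aG p *m row_symmetrizer mu = row_symmetrizer mu.
Proof.
move=> Yp; rewrite mulmx_sumr [RHS](reindex_inj (mulgI p)) /=.
by apply: eq_big => [s | s _]; rewrite ?groupMl // regular_reprM.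
Qed.

Lemma row_symmetrizer_mulr mu p :
  p \in young_subgroup mu -> row_symmetrizer mu *m aG p = row_symmetrizer mu.
Proof.
move=> Yp; rewrite mulmx_suml [RHS](reindex_inj (mulIg p)) /=.
by apply: eq_big => [s | s _]; rewrite ?groupMr // regular_reprM.
Qed.

Lemma column_antisymmetrizer_mulr la q : q \in column_subgroup la ->
  column_antisymmetrizer la *m aG q
    = (-1) ^+ odd_perm q *: column_antisymmetrizer la.
Proof.
move=> Cq; rewrite mulmx_suml scaler_sumr [RHS](reindex_inj (mulIg q)) /=.
apply: eq_big => [s | s _]; rewrite ?groupMr // regular_reprM.
by rewrite -scalemxAl scalerA odd_permM signr_addb mulrC -mulrA -signr_addb
           addbb mulr1.
Qed.

Lemma tperm_fiber_stab (f : nat -> nat) (i j : 'I_n) :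
  f i = f j -> tperm i j \in fiber_stab n f.
Proof.
move=> eq_f; rewrite inE; apply/forallP=> k.
by case: tpermP => [->|->|]; rewrite ?eq_f.
Qed.

Lemma symmetrizers_dominate la mu g :
  column_antisymmetrizer la *m aG g *m row_symmetrizer mu != 0 ->
  dominates la mu.
Proof.
move=> nz; apply: (@transversal_dominates _ _ _ g) => i j eq_c eq_r.
apply: contraNeq nz => ne_ij; set z := (X in X == 0).
have z_opp: z = - z.
  have Cq: tperm i j \in column_subgroup la by apply: tperm_fiber_stab.
  have Yp: (tperm i j ^ g)%g \in young_subgroup mu.
    by rewrite tpermJ; apply: tperm_fiber_stab.
  (* With [t = tperm i j], the row symmetrizer releases [t ^ g], the relation [g * t ^ g = t * g]
     carries it across [g], and the column antisymmetrizer turns [t] into the sign -1. *)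
  rewrite {1}/z -(row_symmetrizer_mull Yp) mulmxA -(mulmxA _ _ (aG _)).
  rewrite -regular_reprM -conjgC regular_reprM mulmxA.
  rewrite column_antisymmetrizer_mulr // odd_tperm ne_ij expr1 scaleN1r.
  by rewrite !mulNmx.
have: z *+ 2 == 0 by rewrite mulr2n {2}z_opp subrr.
rewrite -scaler_nat scaler_eq0 => /orP[two0 | //].
by have := char0 2; rewrite !inE two0.
Qed.

Lemma young_symmetrizerE la :
  young_symmetrizer F la = column_antisymmetrizer la *m row_symmetrizer la.
Proof. by []. Qed.

Lemma row_column_trivial la s :
  s \in young_subgroup la -> s \in column_subgroup la -> s = 1%g.
Proof.
rewrite !inE => /forallP Ys /forallP Cs; apply/permP=> i; rewrite perm1.
by apply: (@intpart_cellK _ la); apply/eqP.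
Qed.

(** A term [q * p] contributes to the coefficient at 1 only if [q] is the inverse of [p]; then [q]
    preserves both rows and columns, so [q = p = 1]. *)
Lemma gring_row_young_neq0 la : gring_row (young_symmetrizer F la) != 0.
Proof.
suffices coef1: gring_proj (1%g : 'S_n) (young_symmetrizer F la) = 1.
  apply: contra_eq_neq coef1 => row0.
  rewrite -[gring_proj _ _]/(row _ (gring_row _)^T) row0 trmx0 linear0.
  by rewrite eq_sym oner_neq0.
rewrite young_symmetrizerE mulmx_suml linear_sum (bigD1 1%g) ?group1 //=.
rewrite [X in _ + X]big1 => [|q /andP[Cq ne_q1]].
  rewrite odd_perm1 scale1r mulmx_sumr linear_sum (bigD1 1%g) ?group1 //=.
  rewrite big1 => [|p /andP[_ ne_p1]].
    by rewrite -regular_reprM mul1g gring_projE ?inE // eqxx !addr0.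
  by rewrite -regular_reprM mul1g gring_projE ?inE // eq_sym (negPf ne_p1).
rewrite mulmx_sumr linear_sum big1 // => p Yp.
rewrite -scalemxAl linearZ /= -regular_reprM gring_projE ?inE // eq_sym.
case: eqP => [qp1 | _]; last by rewrite scaler0.
case/eqP: ne_q1; apply: (@row_column_trivial la) => //.
by rewrite -[q](mulgK p) qp1 mul1g groupV.
Qed.

Lemma chi_diag_neq0 la : chi F la la != 0%N.
Proof.
set U := cyclic_mx aG (gring_row (young_symmetrizer F la)).
have w_in_U: (gring_row (young_symmetrizer F la) <= U)%MS.
  exact: cyclic_mx_id.
rewrite /chi mxrank_eq0; apply: contraNneq (gring_row_young_neq0 la) => fix0.
rewrite -(in_submodK w_in_U) val_submod_eq0 -submx0 -fix0.
apply/rfix_mxP=> p Yp; rewrite -in_submodJ //; congr in_submod.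
by rewrite -gring_row_mul young_symmetrizerE -mulmxA row_symmetrizer_mulr.
Qed.

(** If all the products [b g a] vanish, then [a] acts on a vector fixed by the Young subgroup of
    [mu] both as the order of that subgroup and as 0; in characteristic 0 the vector is zero. *)
Lemma chi_dominates la mu : chi F la mu != 0%N -> dominates la mu.
Proof.
rewrite /chi mxrank_eq0 => nz.
have [g nz_g | all0] := pickP (fun g =>
  column_antisymmetrizer la *m aG g *m row_symmetrizer mu != 0).
  exact: symmetrizers_dominate nz_g.
case/eqP: nz; apply/row_matrixP=> i; rewrite row0.
set u := row i _; apply/eqP; rewrite -val_submod_eq0; set w := val_submod u.
have w_fix p : p \in young_subgroup mu -> w *m aG p = w.
  move=> Yp; rewrite /w -(val_submodJ (cyclic_mx_module _ _)) ?inE //.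
  by congr val_submod; rewrite /u -row_mul rfix_mx_id.
have w_sum: w *m row_symmetrizer mu = #|young_subgroup mu|%:R *: w.
  by rewrite mulmx_sumr (eq_bigr _ w_fix) sumr_const scaler_nat.
have w0: w *m row_symmetrizer mu = 0.
  (* [w] comes from the column antisymmetrizer of [la] times an element of the group algebra;
     expanding the latter over the group leaves only products killed by [all0]. *)
  rewrite /w; have /cyclic_mxP[B R_B ->] := val_submodP u.
  rewrite -!gring_row_mul young_symmetrizerE.
  rewrite -(mulmxA (column_antisymmetrizer la)).
  have: (row_symmetrizer la *m B \in enveloping_algebra_mx aG)%MS.
    apply: envelop_mxM => //; rewrite linear_sum summx_sub // => p _.
    by rewrite envelop_mx_id ?inE.
  case/envelop_mxP=> a ->.
  rewrite [column_antisymmetrizer la *m _]mulmx_sumr mulmx_suml.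
  rewrite big1 ?linear0 // => g _; rewrite -scalemxAr -scalemxAl.
  by have /negbFE/eqP-> := all0 g; rewrite scaler0.
move/eqP: w_sum; rewrite w0 eq_sym scaler_eq0 => /orP[|//].
by have /pcharf0P-> := char0; rewrite -[_ == _]negbK -lt0n cardG_gt0.
Qed.

End Symmetrizers.

(* The prefix weight is strictly monotone for dominance, so a permutation     *)
(* contributing to the Leibniz expansion preserves it, hence is trivial.      *)
Lemma det_chi_matrix (F : fieldType) n : [pchar F] =i pred0 ->
  \det (chi_matrix F n) =
    \prod_(i < #|{: intpart n}|) (chi F (enum_val i) (enum_val i))%:R.
Proof.
move=> char0; rewrite /determinant (bigD1 1%g) //= odd_perm1 mul1r.
rewrite [X in _ + X]big1 ?addr0 => [|s ne_s1].
  by apply: eq_bigr => i _; rewrite perm1 mxE.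
apply/eqP; rewrite mulf_eq0 signr_eq0 /=; apply: contraNT ne_s1 => nz.
pose part (i : 'I_#|{: intpart n}|) : intpart n := enum_val i.
have dom i : dominates (part i) (part (s i)).
  apply: (@chi_dominates F) => //; move/prodf_neq0: nz => /(_ i isT).
  by rewrite mxE pnatr_eq0.
(* Reindexing by [s] preserves the total weight, so equality holds for each [i]. *)
have [_] := leqif_sum (fun i (_ : true) => dominates_weight (dom i)).
rewrite [X in _ == X](reindex_inj (@perm_inj _ s)) eqxx.
move/esym/forallP=> fix_s; apply/eqP/permP=> i; rewrite perm1.
by apply/esym/enum_val_inj/eqP/fix_s.
Qed.

Local Open Scope complex_scope.

Theorem theorem5p3 (R : realType) (n : nat) (hn : (1 <= n)%N) :
  chi_matrix R[i] n \in unitmx.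
Proof.
have char0 : [pchar R[i]] =i pred0 by apply: pchar_num.
rewrite unitmxE unitfE det_chi_matrix //; apply/prodf_neq0=> i _.
by rewrite pnatr_eq0 chi_diag_neq0.
Qed.
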